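(* Let $f^0,\dots,f^N$ and $\eta$ satisfy (H1), (H2) and (H3) as listed in the context. Assume that $x$ is a solution on an interval $I$ of the system $$\dot x^{i}(t)=f^{i}(t,x^i(t),x^{i+1}(t))\ (0\le i\le N-1),\qquad \dot x^N(t)=f^N(t,x^N(t),x^0(\eta(t))),$$ and that $x_t\neq 0$ for some $t\in I$. Then for all $t_1,t_2\in I$ with $t_1<t_2$, $$V(x_{t_1},-\tau(t_1))\ \ge\ V(x_{t_2},-\tau(t_2)).$$
   Context: Fix an integer $N\ge 0$, a real $r>0$, and $\delta\in\{1,-1\}$. Real-valued functions $f^0,\dots,f^N$ of three real variables $(t,u,v)$ and $\eta:\mathbb R\to\mathbb R$ are given; $D_j$ is the partial derivative with respect to the $j$-th argument. For $N=0$ the system is the single equation $\dot x^0(t)=f^0(t,x^0(t),x^0(\eta(t)))$. (H1) The functions $f^0,\dots,f^N$ are continuous in their first argument, and $C^1$ in their other arguments. (H2) For all $t$ and all $v\ne 0$: $v f^i(t,0,v)>0$ and $D_3f^i(t,0,0)>0$ for $0\le i\le N-1$; $\delta v f^N(t,0,v)>0$ and $\delta D_3f^N(t,0,0)>0$. (H3) $\eta$ is continuous and strictly increasing, and the delay $\tau(t):=t-\eta(t)$ satisfies $0<\tau(t)\le r$ for all $t\in\mathbb R$. Phase space: $\mathbb K=[-r,0]\cup\{1,\dots,N\}$ and $\mathcal C_{\mathbb K}=C(\mathbb K,\mathbb R)$ with the sup norm. The segment $x_t\in\mathcal C_{\mathbb K}$ is $x_t(s)=x^0(t+s)$ for $s\in[-r,0]$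 and $x_t(s)=x^s(t)$ for $s\in\{1,\dots,N\}$; $x_t\ne0$ means that $x_t$ is not the zero element of $\mathcal C_{\mathbb K}$. Solutions: a solution on $I=[t_0,\omega)$, $t_0<\omega\le\infty$, is $x=(x^0,\dots,x^N)$ with $x^0:[t_0-r,\omega)\to\mathbb R$ continuous on $[t_0-r,t_0]$ and $C^1$ on $[t_0,\omega)$, $x^i:[t_0,\omega)\to\mathbb R$ of class $C^1$ for $1\le i\le N$, satisfying the system for all $t\in(t_0,\omega)$. An entire solution ($I=\mathbb R$) consists of $C^1$ functions $x^i:\mathbb R\to\mathbb R$ satisfying the system for all $t\in\mathbb R$. Sign changes: for $\varphi\in\mathcal C_{\mathbb K}\setminus\{0\}$ and $a\in[-r,0)$, $\mathrm{sc}(\varphi,a)\in\{0,1,2,\dots\}\cup\{\infty\}$ is the supremum of all integers $k\ge1$ for which there exist $\theta_k<\theta_{k-1}<\dots<\theta_0$ in $[a,0]\cup\{1,\dots,N\}$ with $\varphi(\theta_i)\varphi(\theta_{i-1})<0$ for $1\le i\le k$ (with $\sup\emptyset=0$). If $\delta=1$, $V(\varphi,a)$ equals $\mathrm{sc}(\varphi,a)$ if this is even or infinite, and $\mathrm{sc}(\varphi,a)+1$ if it is odd. If $\delta=-1$, $V(\varphi,a)$ equals $\mathrm{sc}(\varphi,a)$ if this is odd or infinite, and $\mathrm{sc}(\varphi,a)+1$ if it is even. *)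

(* Defs.v *)
From HB Require Import structures.
From mathcomp Require Import all_boot all_order all_algebra.
From mathcomp Require Import all_classical all_reals all_analysis.
Set Implicit Arguments.
Unset Strict Implicit.
Unset Printing Implicit Defensive.
Import Order.TTheory GRing.Theory Num.Theory.
Import numFieldNormedType.Exports.
Local Open Scope classical_set_scope.
Local Open Scope ring_scope.

Section CyclicDelaySystem.
Variable R : realType.

(* The families f^0, ..., f^N and x^0, ..., x^N are indexed by nat; every
   hypothesis below constrains the indices 0, ..., N only. *)
Implicit Types (f : nat -> R -> R -> R -> R) (x : nat -> R -> R).
Implicit Types (eta phi : R -> R) (N : nat) (r delta a t : R).

Definition D2 (g : R -> R -> R -> R) (t u v : R) : R := derive1 (fun w => g t w v) u.
Definition D3 (g : R -> R -> R -> R) (t u v : R) : R := derive1 (fun w => g t u w) v.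

(* "Continuous in t and C^1 in (u, v)": the partial derivatives in u and v are
   continuous jointly in (t, u, v), which with the first clause also makes g
   jointly continuous. *)
Definition H1 N f : Prop := forall i : nat, (i <= N)%N ->
  [/\ forall u v, continuous (fun t => f i t u v),
      forall t u v, derivable (fun w => f i t w v) u 1,
      forall t u v, derivable (fun w => f i t u w) v 1,
      continuous (fun p : R * R * R => D2 (f i) p.1.1 p.1.2 p.2) &
      continuous (fun p : R * R * R => D3 (f i) p.1.1 p.1.2 p.2)].

Definition H2 N delta f : Prop :=
  (forall i : nat, (i < N)%N ->
     (forall t v, v != 0 -> 0 < v * f i t 0 v) /\
     (forall t, 0 < D3 (f i) t 0 0)) /\
  (forall t v, v != 0 -> 0 < delta * v * f N t 0 v) /\
  (forall t, 0 < delta * D3 (f N) t 0 0).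

Definition tau eta t : R := t - eta t.

Definition H3 r eta : Prop :=
  [/\ continuous eta,
      {homo eta : s t / s < t} &
      forall t, 0 < tau eta t <= r].

(* [a, 0] together with {1, ..., N}; the set K of the phase space C(K, R) is
   [sites N (- r)], and its elements are represented by functions on R, of
   which only the values on K matter. *)
Definition sites N a : set R :=
  `[a, 0]%classic `|` [set i%:R | i in [set i : nat | (1 <= i <= N)%N]].

Definition segment x t : R -> R :=
  fun s => if s <= 0 then x 0%N (t + s) else x (Num.truncn s) t.

Definition nonzero_on_K N r phi : Prop :=
  exists2 s, sites N (- r) s & phi s != 0.

(* C^1 on an interval J, the derivative at an endpoint that belongs to J being
   the one-sided one. *)
Definition C1_on (J : set R) (g : R -> R) : Prop :=
  exists2 g' : R -> R, {within J, continuous g'} &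
    forall t, J t -> (g s - g t) / (s - t) @[s --> within J t^'] --> g' t.

Definition satisfies_at N f eta x t : Prop :=
  (forall i : nat, (i < N)%N -> derive1 (x i) t = f i t (x i t) (x i.+1 t)) /\
  derive1 (x N) t = f N t (x N t) (x 0%N (eta t)).

Definition halfopen (t0 : R) (omega : \bar R) : set R :=
  [set t | t0 <= t /\ (t%:E < omega)%E].

Definition forward_solution N r f eta (t0 : R) (omega : \bar R) x : Prop :=
  [/\ {within `[t0 - r, t0]%classic, continuous (x 0%N)},
      forall i : nat, (i <= N)%N -> C1_on (halfopen t0 omega) (x i) &
      forall t, t0 < t -> (t%:E < omega)%E -> satisfies_at N f eta x t].

Definition entire_solution N f eta x : Prop :=
  (forall i : nat, (i <= N)%N -> C1_on setT (x i)) /\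
  (forall t, satisfies_at N f eta x t).

Definition solution_on N r f eta (I : set R) x : Prop :=
  (exists (t0 : R) (omega : \bar R),
     [/\ (t0%:E < omega)%E, I = halfopen t0 omega &
         forward_solution N r f eta t0 omega x]) \/
  (I = setT /\ entire_solution N f eta x).

Definition alternates N phi a (k : nat) : Prop :=
  exists theta : nat -> R,
    (forall i : nat, (i <= k)%N -> sites N a (theta i)) /\
    (forall i : nat, (1 <= i <= k)%N ->
       theta i < theta i.-1 /\ phi (theta i) * phi (theta i.-1) < 0).

(* Values in the extended integers; [supremum 0] takes the value 0 on the empty
   set. The definition also gives a value, namely 0, when phi = 0. *)
Definition sc N phi a : \bar int :=
  supremum (0%Z%:E) [set k%:Z%:E | k in [set k | (1 <= k)%N /\ alternates N phi a k]].

(* Meant for delta = 1 or -1. *)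
Definition V delta N phi a : \bar int :=
  match sc N phi a with
  | EFin k =>
      let keep := if delta == 1 then ~~ odd `|k|%N else odd `|k|%N in
      (if keep then k else k + 1)%:E
  | s => s
  end.

End CyclicDelaySystem.

(* Main.v *)
(* For t1 < t2 with eta(t2) <= t1, put z_i = x^i for i <= N and
   z_(N+1)(s) = delta x^0(eta(s)). By (H2) and Gronwall, z_i can only go from
   nonpositive to positive while z_(i+1) is positive somewhere, and likewise
   with the signs reversed. Hence a sign pattern read along z_i over [t1, t2]
   followed by z_(i+1)(t2) can also be read along z_i(t1) followed by z_(i+1)
   over [t1, t2]. Doing this for i = 0, ..., N moves every alternation of the
   state at t2 to x^0 over [eta(t2), t1], x^1(t1), ..., x^N(t1),
   delta x^0(eta(s)) for s in [t1, t2], which is a cyclic rotation, with a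
   twist by delta, of the state at t1. When delta (-1)^k = -1, undoing the
   rotation loses none of the k sign changes, and V only depends on those k.
   Steps shorter than the minimum of tau cover an arbitrary interval. *)
Require Import Defs.
From HB Require Import structures.
From mathcomp Require Import all_boot all_order all_algebra.
From mathcomp Require Import all_classical all_reals all_analysis.
From mathcomp Require Import ring lra zify.
Import Order.TTheory GRing.Theory Num.Theory.
Import numFieldNormedType.Exports.
Local Open Scope ring_scope.
Local Open Scope classical_set_scope.
Set Implicit Arguments.
Unset Strict Implicit.
Unset Printing Implicit Defensive.

(** * Counting sign changes, and the parity rounding in [V] *)

Lemma supremumE {d} {T : porderType d} (x0 s : T) (A : set T) :
  (A !=set0)%classic -> supremums A s -> supremum x0 A = s.
Proof.
move=> /set0P A0 As; rewrite /supremum (negPf A0).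
by apply: (is_subset1_supremums (xgetPex _ _) As); exists s.
Qed.

Section SignChanges.
Variables (R : realType) (N : nat).
Implicit Types (phi psi : R -> R) (a b delta : R).

Lemma alternates_le phi a k m :
  (k <= m)%N -> alternates N phi a m -> alternates N phi a k.
Proof.
move=> km [th [h1 h2]]; exists th; split=> i hi; first by apply: h1; lia.
by apply: h2; lia.
Qed.

(** Shortening an alternation leaves an alternation, so the lengths that occur are either all of
    them or those up to an attained maximum, read as 0 when there are none. *)
Lemma sc_spec phi a :
  (sc N phi a = +oo%E /\ forall k, alternates N phi a k) \/
  exists n : nat, [/\ sc N phi a = n%:Z%:E,
    (0 < n)%N -> alternates N phi a n &
    forall k, (0 < k)%N -> alternates N phi a k -> (k <= n)%N].
Proof.
rewrite /sc; set A := (X in supremum _ X).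
have Ak k : (0 < k)%N -> alternates N phi a k -> A k%:Z%:E.
  by move=> k0 hk; exists k.
have [allk|/existsNP[k0 nk0]] := pselect (forall k, alternates N phi a k).
  left; split=> //; apply: supremumE; first by exists 1%:Z%:E; apply: Ak.
  split=> [y _|[z| |] hy]; rewrite ?leey //.
  - have := hy `|z|%N.+1%:Z%:E (Ak `|z|%N.+1 isT (allk _)); rewrite lee_fin; lia.
  - by have := hy 1%:Z%:E (Ak 1%N isT (allk _)).
right.
have [k1|n1] := pselect (alternates N phi a 1); last first.
  exists 0%N; split=> [|//|k k_gt0 hk]; last by case: n1; apply: alternates_le hk.
  rewrite [A](_ : _ = set0) ?supremum0//; apply/seteqP; split=> // y [k [k_gt0 hk] _].
  by case: n1; apply: alternates_le hk.
have bnd k : `[< alternates N phi a k >] -> (k <= k0)%N.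
  move=> /asboolP hk; rewrite leqNgt; apply/negP => k0k.
  by apply: nk0; apply: alternates_le hk; lia.
have exk : exists k, `[< alternates N phi a k >] by exists 1%N; apply/asboolP.
case: (ex_maxnP exk bnd) => n /asboolP hn maxn.
have n_gt0 : (0 < n)%N by apply: maxn; apply/asboolP.
exists n; split=> [|//|k _ hk]; last by apply: maxn; apply/asboolP.
apply: supremumE; first by exists n%:Z%:E; apply: Ak.
split=> [_ [k [_ hk] <-]|y]; last by apply; apply: Ak.
by rewrite lee_fin lez_nat; apply: maxn; apply/asboolP.
Qed.

(* [V] rounds [sc] up to the next number of the admissible parity, so only the
   alternations of the opposite parity can make it grow. *)
Lemma V_le delta phi psi a b : delta = 1 \/ delta = -1 ->
  (forall k, (0 < k)%N -> delta * (-1) ^+ k = -1 ->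
     alternates N psi b k -> alternates N phi a k) ->
  (V delta N psi b <= V delta N phi a)%E.
Proof.
move=> hdelta H.
(* For either value of [delta], the parity test in [V] fails exactly at the lengths that the
   hypothesis transfers. *)
have keepE k : (if delta == 1 then ~~ odd k else odd k) =
    (delta * (-1) ^+ k != -1).
  have ne : (1 == - 1 :> R) = false by apply/eqP; lra.
  have ne' : (-1 == 1 :> R) = false by apply/eqP; lra.
  rewrite -signr_odd; case: hdelta => ->; rewrite ?eqxx ?ne';
    by case: (odd k); rewrite /= ?mulrNN ?mulr1 ?mul1r ?eqxx ?ne.
rewrite /V; case: (sc_spec phi a) => [[-> _]|[m [-> _ hm]]]; first by rewrite leey.
case: (sc_spec psi b) => [[-> hk]|[n [-> hn _]]].
  exfalso.
  (* Consecutive lengths have opposite parities, so [m.+1] or [m.+2] is transferable and exceeds the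
     maximum [m]. *)
  have [k km dk] : exists2 k, (m < k)%N & delta * (-1) ^+ k = -1.
    case: (eqVneq (delta * (-1) ^+ m.+1) (-1)) => [e|]; first by exists m.+1.
    rewrite -keepE => e; exists m.+2; first by lia.
    apply/eqP; rewrite -[_ == _]negbK -keepE /=; move: e => /=.
    by case: (delta == 1); case: (odd m).
  by have := hm k (leq_ltn_trans (leq0n _) km) (H _ _ dk (hk k)); lia.
rewrite !absz_nat lee_fin.
have hmn k : (0 < k <= n)%N -> ~~ (if delta == 1 then ~~ odd k else odd k) ->
    (k <= m)%N.
  move=> /andP[k0 kn]; rewrite keepE negbK => /eqP dk.
  by apply: hm => //; apply: H => //; exact: alternates_le kn (hn (leq_trans k0 kn)).
(* For positive [n], either [n] or [n.-1] has the parity that [V] rounds up. A bound by [m] at that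
   index suffices, since in case of equality [m] is rounded up too. *)
have := hmn n; have := hmn n.-1.
case: n {hn hmn} => [|n]; case: (delta == 1) => /=; do ?case: ifP => /=; lia.
Qed.

End SignChanges.

(** * Pushing a sign pattern from the state at [t2] to the state at [t1] *)

Section Chain.
Variables (R : realType) (N : nat) (b t1 t2 : R) (Z : nat -> R -> R).
Hypothesis t12 : t1 < t2.
Hypothesis rise : forall j (eps s s' : R), (j <= N)%N -> eps = 1 \/ eps = -1 ->
  t1 <= s' -> s' < s -> s <= t2 -> eps * Z j s' <= 0 -> 0 < eps * Z j s ->
  exists2 u, s' < u < s & 0 < eps * Z j.+1 u.

(** This is the decreasing order in which [alternates] lists its sites, higher components coming
    first. *)
Definition lexgt (p q : nat * R) : Prop :=
  (q.1 < p.1)%N \/ p.1 = q.1 /\ q.2 < p.2.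

(* Points [(i, s)] of the [j]-th pattern: component [j] ranges over [t1, t2], the
   components before it are taken at [t1], those after it at [t2]. *)
Definition stage (j : nat) (q : nat * R) : Prop :=
  [\/ q.1 = j /\ t1 <= q.2 <= t2, q.1 = 0%N /\ b <= q.2 <= t1,
      (q.1 < j)%N /\ q.2 = t1 | (j < q.1 <= N)%N /\ q.2 = t2].

(** [eps] is the sign of the first letter; [k] counts sign changes, so there are [k.+1] letters. *)
Definition word (j k : nat) (eps : R) (p : nat -> nat * R) : Prop :=
  (forall i, (i <= k)%N -> stage j (p i) /\
     0 < eps * (-1) ^+ i * Z (p i).1 (p i).2) /\
  (forall i, (i < k)%N -> lexgt (p i) (p i.+1)).

(** Letters on component [j] at times from [t1] on move to component [j.+1], at times supplied by
    [rise]. Only the last of them may stay on component [j], at time [t1], when the sign there is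
    right. All other letters keep their place. *)
Lemma word_step j k eps p : (j <= N)%N -> eps = 1 \/ eps = -1 ->
  word j k eps p -> exists q, word j.+1 k eps q.
Proof.
move=> jN heps [hS hlt].
have sgn_eps i : eps * (-1) ^+ i = 1 \/ eps * (-1) ^+ i = -1.
  rewrite -signr_odd; case: (odd i); case: heps => ->; rewrite ?mulrN ?mulNr ?expr1 ?expr0 ?mulr1; auto.
  by left; rewrite opprK.
pose H (q : nat * R) : Prop := q.1 = j /\ t1 <= q.2.
pose hole i := (i < k)%N /\ H (p i.+1).
(* The last clause preserves the order: the new time exceeds the old time of the next letter, which
   itself moves to an earlier time. *)
pose Q i (q : nat * R) : Prop := [\/ ~ H (p i) /\ q = p i,
   [/\ H (p i), q = (j, t1) & ~ hole i] |
   [/\ H (p i), q.1 = j.+1, t1 < q.2 < (p i).2 & hole i -> (p i.+1).2 < q.2]].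
have /choice[q hq] : forall i, exists q, (i <= k)%N -> Q i q /\
     0 < eps * (-1) ^+ i * Z q.1 q.2.
  move=> i; have [ik|ki] := leqP i k; last by exists (0%N, t1) => ?; lia.
  have [hSi hi] := hS _ ik.
  have [Hi|nHi] := pselect (H (p i)); last by exists (p i) => _; split=> //; apply: Or31.
  have it2 : (p i).2 <= t2.
    case: hSi => -[e]; case: Hi => e' le.
    - by case/andP.
    - by case/andP=> _ ?; rewrite (le_trans _ (ltW t12)).
    - by move: e; rewrite e' ltnn.
    - by move: e; rewrite e' ltnn.
  case: (Hi) => ij t1i.
  have [hl|nhl] := pselect (hole i).
    case: (hl) => ik1 [i1j t1i1].
    have [_ hi1] := hS _ ik1.
    have lt_i : (p i.+1).2 < (p i).2.
      by case: (hlt _ ik1) => [|[_ //]]; rewrite i1j ij ltnn.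
    (* The next letter has the opposite sign, so [rise] applies between the two old times. *)
    have [||u /andP[u1 u2] hu] := rise jN (sgn_eps i) t1i1 lt_i it2.
    - by move: hi1; rewrite i1j exprS; lra.
    - by rewrite -{1}ij.
    exists (j.+1, u) => _; split=> //; apply: Or33; split=> //=.
    by rewrite u2 (le_lt_trans t1i1 u1).
  have [h1|h1] := ltP 0 (eps * (-1) ^+ i * Z j t1).
    by exists (j, t1) => _; split=> //; apply: Or32.
  have lt_i : t1 < (p i).2.
    rewrite lt_neqAle t1i andbT; apply/eqP => e.
    by move: hi; rewrite -e ij ltNge h1.
  (* For the last moved letter, [t1] serves as the lower end, the sign there being wrong. *)
  have [|u /andP[u1 u2] hu] := rise jN (sgn_eps i) (lexx _) lt_i it2 h1.
    by rewrite -{1}ij.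
  by exists (j.+1, u) => _; split=> //; apply: Or33; split=> //=; rewrite u1 u2.
exists q; split=> [i ik|i ik].
  have [hQ hpos] := hq _ ik; split=> //.
  have [hSi hi] := hS _ ik.
  case: hQ => [[nH ->]|[_ -> _]|[[ij t1i] qj /andP[qt1 qi] _]].
  - case: hSi => -[e h].
    + by case: nH; split=> //; case/andP: h.
    + by apply: Or42.
    + by apply: Or43; split=> //; lia.
    + have [jj|jj] := eqVneq (p i).1 j.+1.
        by apply: Or41; rewrite jj h lexx ltW.
      by apply: Or44; split=> //; lia.
  - by apply: Or43 => /=.
  - apply: Or41; split=> //; rewrite (ltW qt1)/= (le_trans (ltW qi))//.
    case: hSi => -[e h].
    + by case/andP: h.
    + by case/andP: h => _ /le_trans; apply; apply: ltW.
    + by rewrite h ltW.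
    + by rewrite h.
have [hQ _] := hq _ (ltnW ik); have [hQ1 _] := hq _ ik.
have [hSi _] := hS _ (ltnW ik); have [hSi1 _] := hS _ ik; have lti := hlt _ ik.
(* Order of consecutive letters, by cases on how each was treated; a letter put at [(j, t1)] is
   never followed by another moved one. *)
case: hQ => [[nH ->]|[[ij t1i] -> nh]|[[ij t1i] qj /andP[qt1 qi] hh]];
  case: hQ1 => [[nH' ->]//|[[ij' t1i'] -> nh']|[[ij' t1i'] qj' /andP[qt1' qi'] hh']].
- left=> /=; case: lti => [|[e lt]]; first by rewrite ij'.
  by case: nH; split; [rewrite e|exact: le_trans t1i' (ltW lt)].
- have ji : (j < (p i).1)%N.
    case: lti => [|[e lt]]; first by rewrite ij'.
    by case: nH; split; [rewrite e|exact: le_trans t1i' (ltW lt)].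
  case: hSi => -[e h]; try by move: ji e; lia.
  rewrite /lexgt qj' h; have [->|ne] := eqVneq (p i).1 j.+1; last by left; lia.
  right; split=> //; apply: lt_le_trans qi' _.
  case: hSi1 => -[e' h'].
  + by case/andP: h'.
  + by case/andP: h' => _ /le_trans; apply; apply: ltW.
  + by rewrite h' ltW.
  + by rewrite h'.
- rewrite /lexgt/=; case: lti => [|[e lt]]; first by rewrite ij; left.
  right; split; first by rewrite -e ij.
  by rewrite ltNge; apply/negP => le; apply: nH'; split=> //; rewrite -e ij.
- by case: nh.
- by case: nh.
- left; rewrite qj; case: lti => [|[e _]]; first by rewrite ij; lia.
  by rewrite -e ij.
- by left; rewrite qj /=.
- by right; split; [rewrite qj qj'|apply: lt_trans qi' (hh _)].
Qed.

Lemma word_chain k eps p : eps = 1 \/ eps = -1 ->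
  word 0 k eps p -> exists q, word N.+1 k eps q.
Proof.
move=> heps hp.
suff: forall j, (j <= N.+1)%N -> exists q, word j k eps q by apply.
elim=> [_|j IH jN]; first by exists p.
by have [q hq] := IH (ltnW jN); apply: word_step hq.
Qed.

End Chain.

(** * Sign of a scalar unknown driven by another function *)

Section Scalar.
Variable R : realType.
Implicit Types (a b c d e t u w : R).

Lemma within_itv_cvgr (y : R -> R) a b c : {within `[a, b], continuous y} ->
  a <= c < b -> y t @[t --> c^'+] --> y c.
Proof.
move=> cy /andP[ac cb].
have /(continuous_within_itvP _ cb)[] // : {within `[c, b], continuous y}.
by apply: continuous_subspaceW cy; apply: subset_itvr; rewrite bnd_simp.
Qed.

Lemma within_itv_cvgl (y : R -> R) a b c : {within `[a, b], continuous y} ->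
  a < c <= b -> y t @[t --> c^'-] --> y c.
Proof.
move=> cy /andP[ac cb].
have /(continuous_within_itvP _ ac)[] // : {within `[a, c], continuous y}.
by apply: continuous_subspaceW cy; apply: subset_itvl; rewrite bnd_simp.
Qed.

(** The point is the supremum of the times in [[a, b]] where [y] is nonpositive. *)
Lemma last_zero (y : R -> R) a b : a < b ->
  {within `[a, b], continuous y} -> y a <= 0 -> 0 < y b ->
  exists2 c, a <= c < b & y c = 0 /\ forall t, c < t <= b -> 0 < y t.
Proof.
move=> ab cy ya yb.
pose A := [set t | a <= t <= b /\ y t <= 0].
have Aa : A a by split; rewrite // lexx ltW.
have supA : has_sup A by split; [exists a|exists b => t [/andP[]]].
have ubA := sup_upper_bound supA.
set c := sup A in ubA.
have ac : a <= c by apply: ubA.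
have cb : c <= b by apply: ge_sup; [exists a|move=> t [/andP[]]].
have yc : y c <= 0.
  move: ac; rewrite le_eqVlt => /predU1P[<-//|ac].
  rewrite leNgt; apply/negP => yc.
  have : \forall t \near c^'-, 0 < y t.
    by apply: (cvgr_gt (y c)) yc; apply: within_itv_cvgl cy _; rewrite ac.
  move=> [e /= e0 he].
  have [t At ct] := sup_adherent e0 supA; have [_ yt] := At.
  have tc : t <= c by apply: ubA.
  move: tc; rewrite le_eqVlt => /predU1P[tc|tc]; first by move: yt; rewrite tc leNgt yc.
  move: yt; rewrite leNgt he//=.
  by rewrite gtr0_norm ?subr_gt0//; have ct' : c - e < t := ct; lra.
have cb' : c < b by rewrite lt_neqAle cb andbT; apply/eqP => e; move: yc; rewrite e leNgt yb.
have pos t : c < t <= b -> 0 < y t.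
  move=> /andP[ct tb]; rewrite ltNge; apply/negP => yt.
  have : t <= c by apply: ubA; split=> //; rewrite tb (le_trans ac)// ltW.
  by rewrite leNgt ct.
exists c; first by rewrite ac cb'.
split=> //; apply/eqP; rewrite eq_le yc/= leNgt; apply/negP => yc0.
have h1 : \forall t \near c^'+, y t < 0.
  by apply: (cvgr_lt (y c)) yc0; apply: within_itv_cvgr cy _; rewrite ac.
have h2 : \forall t \near c^'+, c < t <= b.
  by near=> t; apply/andP; split; [near: t; exact: nbhs_right_gt|near: t; exact: nbhs_right_le].
have [t [yt ct]] := @filter_ex _ (nbhs c^'+) _ _ (filterI h1 h2).
by have := pos t ct; rewrite ltNge (ltW yt).
Unshelve. all: by end_near.
Qed.

(** Covers both signs of [u]; the bound on the modulus keeps the intermediate point in any ball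
    around 0 that contains [u]. *)
Lemma mvt0 (phi : R -> R) u : (forall w, derivable phi w 1) ->
  exists2 c, `|c| <= `|u| & phi u - phi 0 = derive1 phi c * u.
Proof.
move=> dphi.
have dd w : is_derive w 1 phi (derive1 phi w) by rewrite derive1E; apply: derivableP.
have cphi a b : {within `[a, b], continuous phi}.
  by apply: continuous_subspaceT => w; apply: differentiable_continuous; apply/derivable1_diffP.
have [u0|u0|->] := ltgtP u 0; last first.
- by exists 0 => //; rewrite subrr mulr0.
- have [c] := MVT u0 (fun w _ => dd w) (cphi _ _).
  rewrite in_itv/= subr0 => /andP[c0 cu] ->; exists c => //.
  by rewrite !gtr0_norm// ltW.
- have [c] := MVT u0 (fun w _ => dd w) (cphi _ _).
  rewrite in_itv/= sub0r => /andP[c0 cu] e; exists c => //.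
    by rewrite !ltr0_norm// lerN2 ltW.
  by rewrite -opprB e mulrN opprK.
Qed.

(* If [eps * v] stayed nonpositive, then to the right of the last zero of
   [eps * x], where [D2 g < L], the derivative of [eps * x] would be at most
   [L * (eps * x)]. *)
Lemma driver_sign (g : R -> R -> R -> R) (x v : R -> R) eps a b :
  eps = 1 \/ eps = -1 -> a < b ->
  (forall t, a < t < b -> is_derive t 1 x (g t (x t) (v t))) ->
  {within `[a, b], continuous x} -> {within `[a, b], continuous v} ->
  (forall t u w, derivable (fun u => g t u w) u 1) ->
  continuous (fun p : R * R * R => D2 g p.1.1 p.1.2 p.2) ->
  (forall t w, eps * w <= 0 -> eps * g t 0 w <= 0) ->
  eps * x a <= 0 -> 0 < eps * x b ->
  exists2 u, a < u < b & 0 < eps * v u.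
Proof.
move=> heps ab dx cx cv dg cg sg xa xb.
have eps2 : eps * eps = 1 by case: heps => ->; rewrite ?mulrNN mulr1.
apply: contrapT => /forall2NP hv.
have {}hv t : a < t < b -> eps * v t <= 0.
  by move=> tab; rewrite leNgt; apply/negP; case: (hv t).
have cy : {within `[a, b], continuous (fun t => eps * x t)}.
  by move=> t; apply: cvgM; [apply: cvg_cst|apply: cx].
have [c /andP[ac cb] [yc ypos]] := last_zero ab cy xa xb.
have xc : x c = 0 by rewrite -[x c]mul1r -eps2 -mulrA yc mulr0.
(* Any number above this value of [D2 g] would do; by continuity it remains an upper bound
   nearby. *)
pose L := D2 g c 0 (v c) + 1.
have [d /= d0 hd] : exists2 d, 0 < d & forall t u w,
    `|c - t| < d -> `|u| < d -> `|v c - w| < d -> D2 g t u w < L.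
  have hL : D2 g c 0 (v c) < L by rewrite ltrDl.
  have : nbhs (c, 0, v c) (fun p : R * R * R => D2 g p.1.1 p.1.2 p.2 < L).
    exact: (@cvgr_lt _ _ _ _ _ _ (cg (c, 0, v c)) L hL).
  move=> /nbhs_ballP[d /= d0 hd].
  exists d => // t u w ht hu hw; apply: (hd (t, u, w)).
  by split; [split=> //; rewrite /ball/= sub0r normrN|].
have acb : a <= c < b by rewrite ac.
have /cvgrPdist_lt/(_ d d0) near_x := within_itv_cvgr cx acb.
have /cvgrPdist_lt/(_ d d0) near_v := within_itv_cvgr cv acb.
have : \forall t \near c^'+, [/\ `|c - t| < d, `|x t| < d, `|v c - v t| < d & t < b].
  near=> t; split.
  - rewrite ltr0_norm ?opprB ?subr_lt0; last by near: t; apply: nbhs_right_gt.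
    by rewrite ltrBlDr addrC; near: t; apply: nbhs_right_lt; rewrite ltrDl.
  - rewrite -normrN -[- x t]sub0r -xc; near: t.
    exact: near_x.
  - near: t.
    exact: near_v.
  - by near: t; apply: nbhs_right_lt.
move=> [e /= e0 he].
pose m := c + e / 2.
have e20 : 0 < e / 2 by rewrite divr_gt0.
have cm : c < m by rewrite ltrDl.
have {}he t : c < t <= m ->
   [/\ `|c - t| < d, `|x t| < d, `|v c - v t| < d & t < b].
  move=> /andP[ct tm]; apply: he => //=.
  by rewrite ltr0_norm ?subr_lt0// opprB; move: tm e20; rewrite /m; lra.
(* With this integrating factor, [h] vanishes at [c] and is positive at [m], so its derivative is
   positive somewhere in between. *)
pose h t := expR (- L * t) * (eps * x t).
pose dh t := expR (- L * t) * (eps * g t (x t) (v t)) + expR (- L * t) * - L * (eps * x t).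
have mb : m < b by have [] := he m; rewrite ?cm ?lexx.
have hder t : t \in `]c, m[%R -> is_derive t 1 h (dh t).
  rewrite in_itv/= => /andP[ct tm].
  have := dx t; rewrite (le_lt_trans ac ct) (lt_trans tm mb) => /(_ isT) dxt.
  apply: is_derive_eq.
  rewrite /dh /GRing.scale/=; ring.
have ch : {within `[c, m], continuous h}.
  move=> t; apply: cvgM.
    apply: continuous_subspaceT => s; apply: continuous_comp; last exact: continuous_expR.
    by apply: cvgM; [apply: cvg_cst|apply: cvg_id].
  have: {within `[c, m], continuous (fun t => eps * x t)} by
    apply: continuous_subspaceW cy; apply: subset_itv; rewrite bnd_simp// ltW.
  exact.
have [t] := MVT cm hder ch.
rewrite in_itv/= => /andP[ct tm].
rewrite /h yc mulr0 subr0 => hm.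
have [h1 h2 h3 tb] : [/\ `|c - t| < d, `|x t| < d, `|v c - v t| < d & t < b].
  by apply: he; rewrite ct ltW.
have yt : 0 < eps * x t by apply: ypos; rewrite ct ltW.
have ym : 0 < eps * x m by apply: ypos; rewrite cm ltW.
have atb : a < t < b by rewrite tb (le_lt_trans ac ct).
(* Expanding [g] in its second argument around 0 leaves a term that is nonpositive by [sg] and one
   below [L * (eps * x t)], against the positive derivative of [h]. *)
have [th hth eth] := mvt0 (x t) (fun w => dg t w (v t)).
have hD : D2 g t th (v t) < L by apply: hd => //; apply: le_lt_trans h2.
have := sg t (v t) (hv t atb).
have : 0 < expR (- L * m) * (eps * x m) by rewrite mulr_gt0 ?expR_gt0.
rewrite hm /dh pmulr_lgt0 ?subr_gt0//.
rewrite (_ : _ + _ = expR (- L * t) * (eps * g t (x t) (v t) - L * (eps * x t))); last by ring.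
rewrite pmulr_rgt0 ?expR_gt0// => hpos hneg.
have : eps * g t (x t) (v t) = eps * g t 0 (v t) + D2 g t th (v t) * (eps * x t).
  by rewrite mulrCA -eth; ring.
have : D2 g t th (v t) * (eps * x t) < L * (eps * x t) by rewrite ltr_pM2r.
lra.
Unshelve. all: by end_near.
Qed.

End Scalar.

(** * Regularity of solutions on compact time intervals *)

Section Regularity.
Variable R : realType.
Implicit Types (t : R) (J : set R) (g : R -> R).

Lemma within_continuousP J g : {within J, continuous g} <->
  forall t, J t -> g s @[s --> within J (nbhs t)] --> g t.
Proof.
have E t : J t -> nbhs (t : subspace J) = within J (nbhs t).
  by move=> Jt; rewrite (nbhs_subspace_in Jt).
rewrite continuous_subspace_in; split=> [cg t Jt|cg t /set_mem Jt].
  by have := cg t (mem_set Jt); rewrite /continuous_at E.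
by rewrite /continuous_at E//; apply: cg.
Qed.

(** Near [t] the difference quotients are within 1 of [g' t], which gives a Lipschitz estimate at
    [t]. *)
Lemma C1_on_continuous J g : C1_on J g -> {within J, continuous g}.
Proof.
move=> [g' _ hg]; apply/within_continuousP => t Jt.
apply/cvgrPdist_lt => e e0.
have /cvgrPdist_lt/(_ 1 ltr01) h := hg t Jt.
have k0 : 0 < `|g' t| + 1 by rewrite ltr_wpDl.
have /nbhs_ballP[d /= d0 hd] : nbhs t (fun s => s != t -> J s ->
  `|g' t - (g s - g t) / (s - t)| < 1) by exact: h.
apply/nbhs_ballP; exists (Num.min d (e / (`|g' t| + 1))) => /=.
  by rewrite lt_min d0 divr_gt0.
move=> s /=; rewrite /ball/= lt_min => /andP[sd se] Js.
have [->|st] := eqVneq s t; first by rewrite subrr normr0.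
have hs := hd s sd st Js.
have st0 : s - t != 0 by rewrite subr_eq0.
rewrite distrC -[g s - g t](divfK st0) normrM.
move: se; rewrite ltr_pdivlMr// distrC mulrC; apply: le_lt_trans.
rewrite ler_wpM2r//.
have := ler_distD (g' t) ((g s - g t) / (s - t)) 0.
rewrite !subr0 [X in _ <= X + _]distrC; lra.
Qed.

(** At an interior point of [J], the restriction to [J] in the limit is void nearby. *)
Lemma C1_on_derivable J g t : nbhs t J -> C1_on J g -> derivable g t 1.
Proof.
move=> nJ [g' _ hg]; have Jt := nbhs_singleton nJ.
apply/cvg_ex; exists (g' t); apply/cvgrPdist_lt => e e0.
have /cvgrPdist_lt/(_ e e0) h := hg t Jt.
have /nbhs_ballP[d /= d0 hd] : nbhs t (fun s => s != t -> J s ->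
  `|g' t - (g s - g t) / (s - t)| < e) by exact: h.
move/nbhs_ballP : nJ => [d' /= d'0 hJ].
apply/nbhs_ballP; exists (Num.min d d') => /=; first by rewrite lt_min d0.
move=> s /=; rewrite /ball/= lt_min sub0r normrN => /andP[sd sd'] s0.
have := hd (s + t); rewrite /ball/= opprD addrCA subrr addr0 normrN => /(_ sd).
rewrite -subr_eq0 addrK => /(_ s0) hh.
rewrite /GRing.scale/= mulr1 mulrC; apply: hh; apply: hJ.
by rewrite /ball/= opprD addrCA subrr addr0 normrN.
Qed.

Lemma within_continuous_comp (A B : set R) (g h : R -> R) :
  continuous h -> (forall t, A t -> B (h t)) ->
  {within B, continuous g} -> {within A, continuous (g \o h)}.
Proof.
move=> ch hAB /within_continuousP cg; apply/within_continuousP => t At U /= gU.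
have := cg (h t) (hAB _ At) U gU => /= gU'.
have : nbhs t (fun s => B (h s) -> U (g (h s))) by exact: (ch t _ gU').
by apply: filterS => s hs As; apply/hs/hAB.
Qed.

Variables (N : nat) (r : R) (f : nat -> R -> R -> R -> R) (eta : R -> R).

Lemma solution_on_regular (I : set R) (x : nat -> R -> R) t1 t2 :
  H3 r eta -> solution_on N r f eta I x -> I t1 -> I t2 -> t1 < t2 ->
  [/\ forall i, (i <= N)%N -> {within `[t1, t2], continuous x i},
      {within `[eta t1, t2], continuous x 0%N},
      forall i t, (i <= N)%N -> t1 < t < t2 -> derivable (x i) t 1 &
      forall t, t1 < t < t2 -> satisfies_at N f eta x t].
Proof.
move=> [_ _ htau] [[t0 [om [t0om -> [cx0 hC1 hsat]]]]|[-> [hC1 hsat]]] I1 I2 t12;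
  last first.
  split=> //.
  - by move=> i iN; apply: continuous_subspaceW (C1_on_continuous (hC1 i iN)).
  - by apply: continuous_subspaceW (C1_on_continuous (hC1 0%N _)).
  - by move=> i t iN _; apply: C1_on_derivable (hC1 i iN); apply: filterT.
case: I1 => t01 _; case: I2 => _ t2om.
have sub a b : t0 <= a -> b <= t2 -> `[a, b] `<=` halfopen t0 om.
  move=> ta bt s /=; rewrite in_itv/= => /andP[as_ sb].
  split; first exact: le_trans as_.
  by apply: le_lt_trans t2om; rewrite lee_fin (le_trans sb).
split.
- move=> i iN; apply: continuous_subspaceW (C1_on_continuous (hC1 i iN)).
  exact: sub.
(* The initial history on [[t0 - r, t0]] is glued to the solution on [[t0, t2]]; the union reaches
   back to [eta t1] because the delay is at most [r]. *)
- have c02 : {within `[t0, t2], continuous (x 0%N)}.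
    by apply: continuous_subspaceW (C1_on_continuous (hC1 0%N _)) => //; apply: sub.
  apply: continuous_subspaceW (withinU_continuous _ _ cx0 c02).
  + move=> s /=; rewrite !in_itv/= => /andP[es ->].
    have /andP[_] := htau t1; rewrite /tau => tr.
    case: (leP s t0) => st; [left|right]; last by rewrite ltW.
    by rewrite andbT; lra.
  + exact: itv_closed.
  + exact: itv_closed.
- move=> i t iN /andP[t1t tt2]; apply: C1_on_derivable (hC1 i iN).
  have : nbhs t `]t1, t2[ by apply: near_in_itvoo; rewrite in_itv/= t1t.
  apply: filterS => s /=; rewrite in_itv/= => /andP[s1 s2].
  by apply: (sub t1 t2) => //=; rewrite in_itv/= !ltW.
- move=> t /andP[t1t tt2]; apply: hsat; first exact: le_lt_trans t1t.
  by apply: lt_trans t2om; rewrite lte_fin.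
Qed.

End Regularity.

(** * The components of a solution satisfy the rise property *)

Section OneStep.
Variables (R : realType) (N : nat) (r delta : R).
Variables (f : nat -> R -> R -> R -> R) (eta : R -> R) (x : nat -> R -> R).
Hypothesis hdelta : delta = 1 \/ delta = -1.

Let delta2 : delta * delta = 1.
Proof. by case: hdelta => ->; rewrite ?mulrNN mulr1. Qed.

(** Absorbing [delta] into the component after [N] makes the last equation a positive feedback like
    the others. *)
Definition state j s : R := if (j <= N)%N then x j s else delta * x 0%N (eta s).

(** For nonzero [w] the signs multiply out. The sign condition is silent at 0, where continuity
    forces [phi 0 = 0]. *)
Lemma feedback_sign (phi : R -> R) (d eps w : R) : derivable phi 0 1 ->
  (forall w, w != 0 -> 0 < d * w * phi w) ->
  eps * (d * w) <= 0 -> eps * phi w <= 0.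
Proof.
move=> /derivable1_diffP/differentiable_continuous cphi hphi hw.
have [->|w0] := eqVneq w 0; last first.
  have [e0|ne0] := eqVneq eps 0; first by rewrite e0 mul0r.
  have e2 : 0 < eps * eps by rewrite -expr2 exprn_even_gt0.
  have : 0 < (eps * (d * w)) * (eps * phi w).
    by rewrite mulrACA mulr_gt0// hphi.
  by apply: contraTT; rewrite -ltNge -leNgt => h; rewrite pmulr_lle0.
suff -> : phi 0 = 0 by rewrite mulr0.
apply/eqP; apply: contrapT => /negP phi0.
have /cvgrPdist_lt/(_ `|phi 0|) := cphi.
rewrite normr_gt0 => /(_ phi0) /nbhs_ballP[e /= e0 he].
have h t : `|t| < e -> 0 < phi 0 * phi t.
  move=> te; have := he t; rewrite /ball/= sub0r normrN => /(_ te).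
  have [p|p|e1] := ltgtP (phi 0) 0; last by rewrite e1 eqxx in phi0.
    by rewrite ltr_norml (ltr0_norm p) => /andP[h1 h2]; rewrite nmulr_rgt0//; lra.
  by rewrite ltr_norml (gtr0_norm p) => /andP[h1 h2]; rewrite pmulr_rgt0//; lra.
(* At [m] and [- m] the function would share the sign of [phi 0], while the sign condition makes the
   two values opposite. *)
have [m m0 me] : exists2 m, 0 < m & m < e by exists (e / 2); lra.
have h1 := h m; have h2 := h (- m).
rewrite ?normrN (gtr0_norm m0) in h1 h2.
have := hphi m (lt0r_neq0 m0); have := hphi (- m).
rewrite oppr_eq0 => /(_ (lt0r_neq0 m0)).
rewrite mulrN mulNr ![d * _]mulrC -!mulrA oppr_gt0 pmulr_rlt0// pmulr_rgt0//.
have := h1 me; have := h2 me.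
set a := phi 0; set b := phi (- _); set c := phi _ => ab ac db dc.
have bc : 0 < b * c.
  have a2 : 0 < a * a by rewrite -expr2 exprn_even_gt0.
  by rewrite -(pmulr_rgt0 _ a2) mulrACA mulr_gt0.
have : (d * b) * (d * c) < 0 by rewrite nmulr_rlt0.
by rewrite mulrACA pmulr_llt0// -expr2 ltNge sqr_ge0.
Qed.

Hypotheses (hH1 : H1 N f) (hH2 : H2 N delta f) (hH3 : H3 r eta).

Lemma state_rise t1 t2 j (eps s s' : R) :
  (forall i, (i <= N)%N -> {within `[t1, t2], continuous x i}) ->
  {within `[eta t1, t2], continuous x 0%N} ->
  (forall i t, (i <= N)%N -> t1 < t < t2 -> derivable (x i) t 1) ->
  (forall t, t1 < t < t2 -> satisfies_at N f eta x t) ->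
  (j <= N)%N -> eps = 1 \/ eps = -1 -> t1 <= s' -> s' < s -> s <= t2 ->
  eps * state j s' <= 0 -> 0 < eps * state j s ->
  exists2 u, s' < u < s & 0 < eps * state j.+1 u.
Proof.
move=> cx c0 dx sat jN heps ts' ss' st2.
have sub : `[s', s] `<=` `[t1, t2] by apply: subset_itv; rewrite bnd_simp.
have inside t : s' < t < s -> t1 < t < t2.
  by move=> /andP[h1 h2]; rewrite (le_lt_trans ts' h1) (lt_le_trans h2 st2).
have [_ df _ cD2 _] := hH1 jN.
have cxj := continuous_subspaceW sub (cx j jN).
have dfv : forall t, derivable (fun v => f j t 0 v) 0 1 by have [_ _ + _ _] := hH1 jN.
have [hlt [hN _]] := hH2.
have [ceta meta htau] := hH3.
rewrite /state jN => h1 h2.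
have [jN'|Nj] := ltnP j N.
  apply: (driver_sign (g := f j) (x := x j)) => //.
  - move=> t /inside tt; have [e _] := sat t tt.
    by rewrite -e// derive1E; apply: derivableP; apply: dx.
  - exact: continuous_subspaceW (cx j.+1 jN').
  - move=> t w hw; apply: (feedback_sign (d := 1)) (dfv t) _ _.
      by move=> v v0; rewrite mul1r; apply: (hlt j jN').1.
    by rewrite mul1r.
have ej : j = N by apply/eqP; rewrite eqn_leq jN.
subst j.
(* As [delta] squares to 1, this field at the component after [N] is the right-hand side of the last
   equation. *)
apply: (driver_sign (g := fun t u w => f N t u (delta * w)) (x := x N)) => //.
- move=> t /inside tt; have [_ e] := sat t tt.
  by rewrite mulrA delta2 mul1r -e derive1E; apply: derivableP; apply: dx.
- have h : {within `[s', s], continuous (x 0%N \o eta)}.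
    apply: within_continuous_comp c0 => // t /=; rewrite !in_itv/= => /andP[t1' t2'].
    have le := ltW_homo meta.
    rewrite le ?(le_trans ts')//=.
    have := htau t; rewrite /tau => /andP[h _]; move: h st2 t2'; lra.
  by move=> t; apply: cvgM; [apply: cvg_cst|apply: h].
- move=> p.
  apply: (@continuous_comp _ _ _ (fun p : R * R * R => (p.1, delta * p.2))
    (fun p : R * R * R => D2 (f N) p.1.1 p.1.2 p.2)); last exact: cD2.
  have h : delta * q.2 @[q --> p] --> delta * p.2.
    by apply: cvgM; [apply: cvg_cst|apply: cvg_snd].
  exact: (cvg_pair (cvg_fst : q.1 @[q --> p] --> p.1) h).
- move=> t w hw; apply: (feedback_sign (d := delta)) (dfv t) _ _.
    by move=> v v0; apply: hN.
  by rewrite [delta * (_ * _)]mulrA delta2 mul1r.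
Qed.

End OneStep.

(** * Translation between sites of a state and letters of a word *)

Section Transfer.
Variables (R : realType) (N : nat) (r delta : R).
Variables (eta : R -> R) (x : nat -> R -> R).
Hypothesis hdelta : delta = 1 \/ delta = -1.
Hypothesis hH3 : H3 r eta.
Local Notation state := (state N delta eta x).

Definition signed (eps : R) (i : nat) (z : R) : Prop := 0 < eps * (-1) ^+ i * z.

Lemma mul_self_gt0 (a b : R) : 0 < a * b -> 0 < a * a.
Proof.
by move=> ab; rewrite -expr2 exprn_even_gt0//; apply: contraTneq ab => ->; rewrite mul0r ltxx.
Qed.

(** [eps] is the sign at [th 0]; each sign change then determines the next sign. *)
Lemma signed_alternation (phi : R -> R) (th : nat -> R) k :
  (0 < k)%N -> (forall i, (1 <= i <= k)%N -> phi (th i) * phi (th i.-1) < 0) ->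
  exists2 eps, eps = 1 \/ eps = -1 & forall i, (i <= k)%N -> signed eps i (phi (th i)).
Proof.
move=> k0 alt.
have ne0 : phi (th 0%N) != 0.
  by have := alt 1%N k0; apply: contraTneq => /= ->; rewrite mulr0 ltxx.
exists (Num.sg (phi (th 0%N))).
  by case: (sgrP (phi (th 0%N))) ne0; rewrite ?eqxx; auto.
rewrite /signed; elim=> [_|i IH ik].
  by rewrite mulr1 -normrEsg normr_gt0.
have := alt i.+1 ik => /=; have := IH (ltnW ik).
set s := _ * _ ^+ i => hs hi.
have s2 := mul_self_gt0 hs.
rewrite exprS mulN1r mulrN mulNr oppr_gt0.
rewrite -(pmulr_llt0 _ hs) mulrACA pmulr_rlt0//.
Qed.

Lemma signed_opp eps i z z' : signed eps i z -> signed eps i.+1 z' -> z * z' < 0.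
Proof.
rewrite /signed exprS => h h'.
rewrite -(pmulr_rlt0 _ (mul_self_gt0 h)).
rewrite mulrACA pmulr_rlt0//; move: h'; lra.
Qed.

(* The [N.+1]-st component at time [s] stands for the site [eta s - t1] of the
   state at [t1], where the value is [delta] times that of the component. *)
Definition site_of t1 (q : nat * R) : R :=
  if q.1 == N.+1 then eta q.2 - t1 else if q.1 == 0%N then q.2 - t1 else q.1%:R.

(** The component and time from which [segment x t2] reads its value at [s]. *)
Definition point_of t2 (s : R) : nat * R :=
  if s <= 0 then (0%N, t2 + s) else (Num.truncn s, t2).

Lemma natr_gt0F n : (0 < n)%N -> (n%:R <= 0 :> R) = false.
Proof. by move=> n0; apply/negbTE; rewrite -ltNge ltr0n. Qed.

Lemma word_of_alternation t1 t2 k : t1 < t2 -> eta t2 <= t1 -> (0 < k)%N ->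
  alternates N (segment x t2) (- tau eta t2) k ->
  exists2 eps, eps = 1 \/ eps = -1 &
    exists p, word N (eta t2) t1 t2 state 0 k eps p.
Proof.
move=> t12 et2 k0 [th [hsite hth]].
have [|eps heps hsg] := signed_alternation (phi := segment x t2) (th := th) k0.
  by move=> i /hth[].
exists eps => //; exists (fun i => point_of t2 (th i)); split=> [i ik|i ik].
  split; last first.
    have := hsg i ik; rewrite /signed /segment /point_of /state.
    case: (leP (th i) 0) => // thi; case: (hsite i ik) => [/=|[n /= /andP[n0 nN] e]].
      by rewrite in_itv/= [th i <= 0]leNgt thi andbF.
    by rewrite -e natrK nN.
  rewrite /point_of; case: (hsite i ik) => [/=|[n /= /andP[n0 nN] <-]].
    rewrite in_itv/= /tau => /andP[h1 h2]; rewrite h2.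
    (* [t1] splits [[eta t2, t2]] between the two clauses of [stage] for component 0. *)
    case: (leP (t2 + th i) t1) => h; [apply: Or42|apply: Or41]; split=> //=.
      by rewrite h andbT; lra.
    by rewrite ltW//; lra.
  rewrite natr_gt0F// natrK; apply: Or44; split=> //=.
  by rewrite n0.
have [lti _] := hth i.+1 ik; rewrite /lexgt /point_of; move: lti => /=.
case: (leP (th i) 0) (hsite i (ltnW ik)) => h.
  move=> _ lt; rewrite (ltW (lt_le_trans lt h)); right; split=> //=.
  by rewrite ltrD2l.
case=> [/=|[n /= /andP[n0 nN] e]]; first by rewrite in_itv/= [th i <= 0]leNgt h andbF.
rewrite -e natrK; case: (leP (th i.+1) 0) (hsite i.+1 ik) => h'; first by left.
case=> [/=|[m /= /andP[m0 mN] e']]; first by rewrite in_itv/= [th i.+1 <= 0]leNgt h' andbF.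
by rewrite -e' natrK ltr_nat; left.
Qed.

(** Letters on component [N.+1] come first but have the lowest sites at [t1], so they are moved to
    the end. The factor [delta] acts on that whole block, which keeps the sign changes inside it;
    the seam from the last letter to the first is a sign change because [delta * (-1) ^+ k = -1]. *)
Lemma alternation_of_word t1 t2 k eps q : t1 < t2 -> eta t2 <= t1 ->
  (0 < k)%N -> delta * (-1) ^+ k = -1 -> eps = 1 \/ eps = -1 ->
  word N (eta t2) t1 t2 state N.+1 k eps q ->
  alternates N (segment x t1) (- tau eta t1) k.
Proof.
move=> t12 et2 k0 dk heps [hS hlt].
have [ceta meta htau] := hH3.
have lemeta := ltW_homo meta.
have delta2 : delta * delta = 1 by case: hdelta => ->; rewrite ?mulrNN mulr1.
have eps2 : eps * eps = 1 by case: heps => ->; rewrite ?mulrNN mulr1.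
have et12 : eta t1 < eta t2 by apply: meta.
have hst i : (i <= k)%N -> [\/ (q i).1 = N.+1 /\ t1 <= (q i).2 <= t2,
    (q i).1 = 0%N /\ eta t2 <= (q i).2 <= t1 |
    (0 < (q i).1 <= N)%N /\ (q i).2 = t1].
  move=> ik; have [hs _] := hS i ik.
  case: hs => -[e h]; [exact: Or31|exact: Or32| |lia].
  case: (posnP (q i).1) => h0; last by apply: Or33; split=> //; lia.
  by apply: Or32; rewrite h lexx et2.
pose S i := site_of t1 (q i).
have hsites i : (i <= k)%N -> sites N (- tau eta t1) (S i).
  move=> /hst; rewrite /S /site_of /tau; case=> -[e h].
  - rewrite e eqxx; left; rewrite /= in_itv/=; case/andP: h => /lemeta h1 /lemeta h2.
    by apply/andP; split; lra.
  - by rewrite e/=; left; rewrite /= in_itv/=; case/andP: h => h1 h2; apply/andP; split; lra.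
  - have n1 : ((q i).1 == N.+1) = false by apply/negbTE; lia.
    have n0 : ((q i).1 == 0%N) = false by apply/negbTE; lia.
    by rewrite n1 n0; right; exists (q i).1.
have hseg i : (i <= k)%N -> segment x t1 (S i) =
    (if (q i).1 == N.+1 then delta else 1) * state (q i).1 (q i).2.
  move=> /hst; rewrite /S /site_of /segment /state; case=> -[e h].
  - rewrite e eqxx ltnn mulrA delta2 mul1r; case/andP: h => _ /lemeta h2.
    by rewrite ifT ?subrKC//; lra.
  - by rewrite e/= mul1r; case/andP: h => _ h2; rewrite ifT ?subrKC//; lra.
  - have n1 : ((q i).1 == N.+1) = false by apply/negbTE; lia.
    have n0 : ((q i).1 == 0%N) = false by apply/negbTE; lia.
    have [q0 qN] := andP e.
    by rewrite n1 n0 natr_gt0F// natrK mul1r qN h.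
have ordA i : (i < k)%N -> (q i).1 = N.+1 -> (q i.+1).1 = N.+1 -> S i.+1 < S i.
  move=> ik e e'; have := hlt i ik; rewrite /lexgt /S /site_of e e' eqxx ltnn.
  by case=> // -[_ lt]; rewrite ltrD2r meta.
have ordB i : (i < k)%N -> (q i).1 != N.+1 -> (q i.+1).1 != N.+1 -> S i.+1 < S i.
  move=> ik e e'; have := hlt i ik; have := hst i (ltnW ik); have := hst i.+1 ik.
  rewrite /lexgt /S /site_of (negPf e) (negPf e').
  case=> -[i0 hh]; first by rewrite i0 eqxx in e'.
    rewrite i0 /= => -[] [j0 h].
    - by rewrite j0 eqxx in e.
    - by rewrite j0/= => -[//|[_ lt]]; rewrite ltrD2r.
    - case/andP: j0 => j0 _; rewrite (gtn_eqF j0) => _.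
      by rewrite ltrBlDr (@le_lt_trans _ _ t1) ?ltrDr ?ltr0n//; case/andP: hh.
  case/andP: i0 => i0 _; rewrite (gtn_eqF i0) => -[] [j0 h].
  - by rewrite j0 eqxx in e.
  - by rewrite j0 => -[//|[i0' _]]; rewrite -i0' in i0.
  - case/andP: (j0) => j0' _; rewrite (gtn_eqF j0') ltr_nat => -[//|[_]].
    by rewrite h hh ltxx.
(* [c] will be the length of the initial block on component [N.+1]; the first disjunct makes it
   [k.+1] when the block is the whole word. *)
have exc : exists c, (k < c)%N || ((q c).1 != N.+1) by exists k.+1; rewrite ltnSn.
case: (ex_minnP exc) => c hc minc.
have ck : (c <= k.+1)%N by apply: minc; rewrite ltnSn.
have ltc i : (i < c)%N -> (q i).1 = N.+1.
  move=> ic; apply/eqP; apply: contraTT ic => h; rewrite -leqNgt.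
  by apply: minc; rewrite h orbT.
have gec i : (c <= i <= k)%N -> (q i).1 != N.+1.
  elim: i => [|i IH] /andP[ci ik].
    by move: hc; rewrite (_ : c = 0%N); [rewrite ltn0|lia].
  move: ci; rewrite leq_eqVlt => /predU1P[e|ci].
    by move: hc; rewrite e ltnNge ik.
  have := IH; rewrite (ltnW ik) andbT => /(_ ci).
  have := hst i (ltnW ik) => -[] [e _]; first by rewrite e eqxx.
    by have := hlt i ik; rewrite /lexgt e => -[//|[<- _]].
  have := hlt i ik; rewrite /lexgt => -[lt|[<- //]] _.
  by apply/eqP; lia.
(* The rotation that brings the components [N.+1] last, as the lowest sites. *)
pose u i := if (c + i <= k)%N then (c + i)%N else (c + i - k.+1)%N.
have uk i : (i <= k)%N -> (u i <= k)%N by move=> ik; rewrite /u; case: ifP => // _; lia.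
exists (S \o u); split=> [i ik|[//|i] /andP[_ ik]] /=; first exact/hsites/uk.
have [hs hs'] := (hseg _ (uk _ (ltnW ik)), hseg _ (uk _ ik)).
have sq (d z z' : R) : d * d = 1 -> z * z' < 0 -> (d * z') * (d * z) < 0.
  by move=> d2 zz; rewrite mulrACA d2 mul1r mulrC.
have [_ sg] := hS _ (uk _ (ltnW ik)); have [_ sg'] := hS _ (uk _ ik).
have [h|h] := leqP (c + i.+1) k.
  have e : u i = (c + i)%N by rewrite /u ifT//; lia.
  have e' : u i.+1 = (c + i).+1 by rewrite /u h addnS.
  have n1 := gec (c + i)%N; have n2 := gec (c + i).+1.
  rewrite -e in n1; rewrite -e' in n2.
  have {}n1 : (q (u i)).1 != N.+1 by apply: n1; lia.
  have {}n2 : (q (u i.+1)).1 != N.+1 by apply: n2; lia.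
  split; first by rewrite e' e; apply: ordB; rewrite -?e' -?e//; lia.
  rewrite hs hs' (negPf n1) (negPf n2); apply: sq; first by rewrite mulr1.
  by apply: (signed_opp (i := u i) (eps := eps)) => //; rewrite [in X in signed _ X]e -e'.
have [h'|h'] := ltnP k (c + i).
  have e' : u i.+1 = (u i).+1 by rewrite /u !ifF; lia.
  have n1 : (q (u i)).1 = N.+1 by apply: ltc; rewrite /u ifF; lia.
  have n2 : (q (u i.+1)).1 = N.+1 by apply: ltc; rewrite /u ifF; lia.
  split; first by rewrite e'; apply: ordA; rewrite -?e'//; have := uk _ ik; lia.
  rewrite hs hs' n1 n2 eqxx; apply: sq => //.
  rewrite n1 in sg; rewrite n2 in sg'.
  by apply: (signed_opp (i := u i) (eps := eps)) => //; rewrite -e'.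
(* The seam, where the last letter is followed by the first. *)
have e : u i = k by rewrite /u ifT; lia.
have e' : u i.+1 = 0%N by rewrite /u ifF; lia.
have n1 : (q (u i)).1 != N.+1 by apply: gec; rewrite e; lia.
have n2 : (q (u i.+1)).1 = N.+1 by apply: ltc; rewrite e'; lia.
have neg : segment x t1 (S (u i.+1)) * segment x t1 (S (u i)) < 0.
  rewrite hs hs' (negPf n1) n2 eqxx mul1r; rewrite n2 in sg'.
  set z' := state N.+1 _ in sg' *; set z := state _ _ in sg *.
  rewrite e' expr0 mulr1 in sg'; rewrite e in sg.
  have : 0 < (eps * z') * (eps * (-1) ^+ k * z) by rewrite mulr_gt0.
  rewrite -[eps * _ * z]mulrA mulrACA eps2 mul1r => pos.
  have -> : delta * z' * z = - (z' * ((-1) ^+ k * z)).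
    have -> : delta = - (-1) ^+ k.
      have s2 := sqrr_sign R k; rewrite expr2 in s2.
      by rewrite -[LHS]mulr1 -[X in _ * X = _]s2 mulrA dk mulN1r.
    by ring.
  by rewrite oppr_lt0.
(* The order argument is only weak here, as both sites could be [eta t2 - t1]; the negative product
   makes them distinct. *)
split=> //; rewrite lt_neqAle; apply/andP; split.
  by apply: contraTneq neg => ->; rewrite -leNgt -expr2 sqr_ge0.
have := hst _ (uk _ (ltnW ik)); rewrite /S /site_of n2 eqxx (negPf n1).
have le2 : eta (q (u i.+1)).2 <= eta t2.
  have := hst _ (uk _ ik); rewrite n2 => -[] [] //; last by rewrite ltnn andbF.
  by move=> _ /andP[_ /lemeta].
case=> -[i0 hh]; first by rewrite i0 eqxx in n1.
  by rewrite i0/= lerD2r; case/andP: hh => [/(le_trans le2)].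
case/andP: i0 => i0 _; rewrite (gtn_eqF i0); apply: (@le_trans _ _ 0); last exact: ler0n.
by rewrite subr_le0 (le_trans le2).
Qed.

End Transfer.

(** * From short steps to arbitrary intervals *)

Section Monotonicity.
Variables (R : realType) (N : nat) (r delta : R).
Variables (f : nat -> R -> R -> R -> R) (eta : R -> R).
Variables (I : set R) (x : nat -> R -> R).
Hypotheses (hdelta : delta = 1 \/ delta = -1) (hH1 : H1 N f)
  (hH2 : H2 N delta f) (hH3 : H3 r eta) (hx : solution_on N r f eta I x).

Lemma V_step t1 t2 : I t1 -> I t2 -> t1 < t2 -> eta t2 <= t1 ->
  (V delta N (segment x t2) (- tau eta t2)
     <= V delta N (segment x t1) (- tau eta t1))%E.
Proof.
move=> I1 I2 t12 et2; apply: V_le => // k k0 dk alt.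
have [cx c0 dx sat] := solution_on_regular hH3 hx I1 I2 t12.
have [eps heps [p hp]] := word_of_alternation delta t12 et2 k0 alt.
have rise := state_rise hdelta hH1 hH2 hH3 cx c0 dx sat.
have [q hq] := word_chain t12 rise heps hp.
exact: (alternation_of_word hdelta hH3 t12 et2 k0 dk heps hq).
Qed.

Lemma solution_on_between t1 t2 s : I t1 -> I t2 -> t1 <= s <= t2 -> I s.
Proof.
case: hx => [[t0 [om [_ -> _]]] | [-> //]] [t01 _] [_ t2om] /andP[t1s st2].
by split; [exact: le_trans t1s|apply: le_lt_trans t2om; rewrite lee_fin].
Qed.

Lemma V_nonincreasing t1 t2 : I t1 -> I t2 -> t1 < t2 ->
  (V delta N (segment x t2) (- tau eta t2)
     <= V delta N (segment x t1) (- tau eta t1))%E.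
Proof.
move=> I1 I2 t12; have [ceta _ htau] := hH3.
have ctau : {within `[t1, t2], continuous (tau eta)}.
  by apply: continuous_subspaceT => s; apply: cvgB; [apply: cvg_id|apply: ceta].
have [m _ minm] := EVT_min (ltW t12) ctau.
have /andP[c0 _] := htau m; set c := tau eta m in minm c0.
have step s : t1 <= s <= t2 -> eta s <= s - c.
  by move=> hs; have := minm s; rewrite in_itv/= hs /tau => /(_ isT); lra.
(* Induction on a bound [n] for the number of steps of length [c], the positive minimum of the
   delay, from [t1] to [s]. *)
have main n : forall s, t1 < s <= t2 -> s - t1 <= n%:R * c ->
    (V delta N (segment x s) (- tau eta s)
       <= V delta N (segment x t1) (- tau eta t1))%E.
  elim: n => [|n IH] s /andP[t1s st2]; first by rewrite mul0r subr_le0 leNgt t1s.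
  rewrite -natr1 mulrDl mul1r => hs.
  have Is : I s by apply: solution_on_between I1 I2 _; rewrite (ltW t1s).
  have es : eta s <= s - c by apply: step; rewrite (ltW t1s).
  have [h|h] := leP (s - c) t1; first by apply: V_step => //; apply: le_trans h.
  have s't2 : s - c <= t2 by lra.
  apply: (@le_trans _ _ (V delta N (segment x (s - c)) (- tau eta (s - c)))).
    apply: V_step => //; last by lra.
    by apply: solution_on_between I1 I2 _; rewrite (ltW h).
  by apply: IH; [rewrite h|lra].
apply: (main (Num.truncn ((t2 - t1) / c)).+1); first by rewrite t12 lexx.
by rewrite -ler_pdivrMr// ltW// truncnS_gt.
Qed.

End Monotonicity.

Unset Implicit Arguments.

Theorem theorem3p3 (R : realType) (N : nat) (r : R) (hr : 0 < r)
    (delta : R) (hdelta : delta = 1 \/ delta = -1)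
    (f : nat -> R -> R -> R -> R) (eta : R -> R)
    (hH1 : H1 N f) (hH2 : H2 N delta f) (hH3 : H3 r eta)
    (I : set R) (x : nat -> R -> R) (hx : solution_on N r f eta I x)
    (hnz : exists2 t : R, I t & nonzero_on_K N r (segment x t)) :
  forall t1 t2 : R, I t1 -> I t2 -> t1 < t2 ->
    (V delta N (segment x t2) (- tau eta t2)
       <= V delta N (segment x t1) (- tau eta t1))%E.
Proof. exact: V_nonincreasing hdelta hH1 hH2 hH3 hx. Qed.
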